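(* Let $\vec r(u^1,u^2)$ be a surface of class $C^3$ in $\mathbb{R}^3$ with regular coordinate net ($\vec r_1\wedge\vec r_2\ne\vec 0$, where $\vec r_i=\partial\vec r/\partial u^i$), and let $u^1=u^1(t)$, $u^2=u^2(t)$, $t_0<t<t_1$, be a $C^3$ curve on the surface such that, with primes denoting $d/dt$ of $t\mapsto\vec r(u^1(t),u^2(t))$, $(\vec r'\wedge\vec r'')\cdot\vec r'''\neq0$ for all $t\in(t_0,t_1)$. Fix $t$, let $P=\vec r(u^1(t),u^2(t))$, and for sufficiently small $\Delta t>0$ let $Q=\vec r(u^1(t+\Delta t),u^2(t+\Delta t))$ be the moving point on the curve near $P$ with parameter $\Delta t$. Write $$\overrightarrow{PQ}=\chi_1(\Delta t)\vec r_1+\chi_2(\Delta t)\vec r_2+\chi_3(\Delta t)\vec n,$$ with $\vec r_1,\vec r_2$ and the unit normal $\vec n$ taken at $P$, and let $\overrightarrow{PQ}_{\mathcal A}=\chi_1\vec r_1+\chi_2\vec r_2$, $\overrightarrow{PQ}_{\mathcal B}=\chi_1\vec r_1+\chi_3\vec n$, $\overrightarrow{PQ}_{\mathcal C}=\chi_2\vec r_2+\chi_3\vec n$, assumed nonzero for $\Delta t>0$. Below $\chi_i,\chi_i'$ are evaluated at $\Delta t$; $g_{ij},L_{ij},\Gamma_{ij}^k$ are evaluated at $P$; derivatives of $u^i$ are taken at $t$; and all summation indices run over $\{1,2\}$. Then: 1) The rotational speed of $\overrightarrow{PQ}_{\mathcal A}$ with respect to $\Delta t$ is, for $\Delta t>0$,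 $$\begin{aligned}&|\chi_1\vec r_1+\chi_2\vec r_2|^{-3}\,\big|\chi_1^2\chi_2'g_{12}\vec r_1+\chi_2\chi_2'\chi_1g_{22}\vec r_1-\chi_1\chi_2\chi_1'g_{12}\vec r_1-\chi_2^2\chi_1'g_{22}\vec r_1\\&\quad+\chi_1\chi_1'\chi_2g_{11}\vec r_2+\chi_2^2\chi_1'g_{12}\vec r_2-\chi_1^2\chi_2'g_{11}\vec r_2-\chi_1\chi_2\chi_2'g_{12}\vec r_2\big|,\end{aligned}$$ and, for $\Delta t\to0^+$, $$\frac12\left|\sum_k\frac{du^k}{dt}\vec r_k\right|^{-3}\left[\sum_{p,q}C^pC^qg_{pq}\right]^{1/2},$$ where, for $p=1,2$, $$C^p=\sum_{k,l}\left(\sum_{i,j}\Gamma_{ij}^l\frac{du^i}{dt}\frac{du^j}{dt}\frac{du^k}{dt}\frac{du^p}{dt}+\frac{d^2u^l}{dt^2}\frac{du^k}{dt}\frac{du^p}{dt}-\sum_{i,j}\Gamma_{ij}^p\frac{du^i}{dt}\frac{du^j}{dt}\frac{du^k}{dt}\frac{du^l}{dt}-\frac{d^2u^p}{dt^2}\frac{du^k}{dt}\frac{du^l}{dt}\right)g_{kl}.$$ 2) The rotational speed of $\overrightarrow{PQ}_{\mathcal B}$ with respect to $\Delta t$ is, for $\Delta t>0$, $$|\chi_1\vec r_1+\chi_3\vec n|^{-3}\,\big|\chi_3\chi_3'\chi_1\vec r_1-\chi_3^2\chi_1'\vec r_1+\chi_1\chi_1'\chi_3g_{11}\vec n-\chi_1^2\chi_3'g_{11}\vec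 n\big|,$$ and, for $\Delta t\to0^+$ (where $\frac{du^1}{dt}\ne0$), $$\frac12\left|\frac{du^1}{dt}\vec r_1\right|^{-1}\left|\sum_{i,j}L_{ij}\frac{du^i}{dt}\frac{du^j}{dt}\right|.$$ 3) The rotational speed of $\overrightarrow{PQ}_{\mathcal C}$ with respect to $\Delta t$ is, for $\Delta t>0$, $$|\chi_2\vec r_2+\chi_3\vec n|^{-3}\,\big|\chi_3\chi_3'\chi_2\vec r_2-\chi_3^2\chi_2'\vec r_2+\chi_2\chi_2'\chi_3g_{22}\vec n-\chi_2^2\chi_3'g_{22}\vec n\big|,$$ and, for $\Delta t\to0^+$ (where $\frac{du^2}{dt}\neq0$), $$\frac12\left|\frac{du^2}{dt}\vec r_2\right|^{-1}\left|\sum_{i,j}L_{ij}\frac{du^i}{dt}\frac{du^j}{dt}\right|.$$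
   Context: $\wedge$ and $\cdot$ are cross and dot product. $\vec n=\frac{\vec r_1\wedge\vec r_2}{|\vec r_1\wedge\vec r_2|}$ is the unit normal, $g_{ij}=\vec r_i\cdot\vec r_j$ the first fundamental form coefficients, $L_{ij}=\vec r_{ij}\cdot\vec n$ the second fundamental form coefficients, and $\Gamma_{ij}^k$ the Christoffel symbols of the second kind, so that $\vec r_{ij}=\sum_k\Gamma_{ij}^k\vec r_k+L_{ij}\vec n$. For a vector function $\vec w(\Delta t)$, nonzero for small $\Delta t>0$, put $\vec e_{\vec w}=\vec w/|\vec w|$ and $\vec e_{\vec w}(0)=\lim_{\Delta t\to0^+}\vec e_{\vec w}(\Delta t)$. The rotational speed of $\vec w$ with respect to $\Delta t$ is $\left|\frac{d\vec e_{\vec w}}{d\Delta t}\right|$ for $\Delta t>0$, and for ''$\Delta t\to0^+$'' it is $\left|\lim_{\Delta t\to0^+}\frac{\vec e_{\vec w}(\Delta t)-\vec e_{\vec w}(0)}{\Delta t}\right|$. *)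

(* Defs.v *)
From Stdlib Require Import Reals.
From Coquelicot Require Import Coquelicot.
Open Scope R_scope.

(* Coquelicot's norm on a product is the l2 combination of the two norms, so
   the norm of E3 is the Euclidean one: see [norm_E3]. *)
Definition E3 : NormedModule R_AbsRing :=
  prod_NormedModule R_AbsRing
    (prod_NormedModule R_AbsRing R_NormedModule R_NormedModule) R_NormedModule.

Definition vec (a b c : R) : E3 := ((a, b), c).
Definition cx (v : E3) : R := fst (fst v).
Definition cy (v : E3) : R := snd (fst v).
Definition cz (v : E3) : R := snd v.

Definition dot (v w : E3) : R := cx v * cx w + cy v * cy w + cz v * cz w.

Definition cross (v w : E3) : E3 :=
  vec (cy v * cz w - cz v * cy w)
      (cz v * cx w - cx v * cz w)
      (cx v * cy w - cy v * cx w).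

Definition vnorm (v : E3) : R := norm v.

Declare Scope vec_scope.
Delimit Scope vec_scope with V.
Notation "v + w" := (@plus (NormedModule.AbelianGroup _ E3) v w) : vec_scope.
Notation "v - w" := (@minus (NormedModule.AbelianGroup _ E3) v w) : vec_scope.
Notation "a *: v" := (@scal R_AbsRing (NormedModule.ModuleSpace _ E3) a%R v)
  (at level 40, left associativity) : vec_scope.
Notation "0" := (@zero (NormedModule.AbelianGroup _ E3)) : vec_scope.

Lemma norm_E3 (v : E3) : vnorm v = sqrt (dot v v).
Proof.
destruct v as [[a b] c].
change (sqrt (sqrt (Rabs a ^ 2 + Rabs b ^ 2) ^ 2 + Rabs c ^ 2)
        = sqrt (a * a + b * b + c * c)).
rewrite pow2_sqrt, !pow2_abs by (apply Rplus_le_le_0_compat; apply pow2_ge_0).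
f_equal; ring.
Qed.

Inductive idx : Set := I1 | I2.

Definition sum2 (F : idx -> R) : R := F I1 + F I2.
Definition vsum2 (F : idx -> E3) : E3 := (F I1 + F I2)%V.

Definition vDerive_n (f : R -> E3) (n : nat) (s : R) : E3 :=
  vec (Derive_n (fun z => cx (f z)) n s)
      (Derive_n (fun z => cy (f z)) n s)
      (Derive_n (fun z => cz (f z)) n s).

Definition pd (i : idx) (f : R -> R -> R) (x y : R) : R :=
  match i with
  | I1 => Derive (fun z => f z y) x
  | I2 => Derive (fun z => f x z) y
  end.

Definition vpd (i : idx) (f : R -> R -> E3) (x y : R) : E3 :=
  vec (pd i (fun a b => cx (f a b)) x y)
      (pd i (fun a b => cy (f a b)) x y)
      (pd i (fun a b => cz (f a b)) x y).

(* [ex_diff_n f 3 x y]: f and all its iterated partial derivatives of order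
   at most 3 exist and are continuous at (x, y). *)
Definition C3_surface (U : R * R -> Prop) (r : R -> R -> E3) : Prop :=
  forall x y, U (x, y) ->
    ex_diff_n (fun a b => cx (r a b)) 3 x y /\
    ex_diff_n (fun a b => cy (r a b)) 3 x y /\
    ex_diff_n (fun a b => cz (r a b)) 3 x y.

Definition in_itv (t0 t1 : Rbar) (s : R) : Prop := Rbar_lt t0 s /\ Rbar_lt s t1.

(* [ex_derive_n f 3] alone does not entail the existence of the derivatives of
   lower order, since [Derive_n] is total. *)
Definition C3_on (t0 t1 : Rbar) (f : R -> R) : Prop :=
  forall s, in_itv t0 t1 s ->
    (forall k : nat, (k <= 3)%nat -> ex_derive_n f k s) /\
    continuous (Derive_n f 3) s.

Definition unit_normal (r : R -> R -> E3) (x y : R) : E3 :=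
  let c := cross (vpd I1 r x y) (vpd I2 r x y) in (/ vnorm c *: c)%V.

Definition gI (r : R -> R -> E3) (i j : idx) (x y : R) : R :=
  dot (vpd i r x y) (vpd j r x y).

Definition LII (r : R -> R -> E3) (i j : idx) (x y : R) : R :=
  dot (vpd j (vpd i r) x y) (unit_normal r x y).

Definition gI_inv (r : R -> R -> E3) (k l : idx) (x y : R) : R :=
  let det := gI r I1 I1 x y * gI r I2 I2 x y - gI r I1 I2 x y ^ 2 in
  match k, l with
  | I1, I1 => gI r I2 I2 x y / det
  | I2, I2 => gI r I1 I1 x y / det
  | _, _ => - gI r I1 I2 x y / det
  end.

(* Gamma_{ij}^k, computed from the metric; for a regular C^2 surface it is also
   the coefficient of r_k in the Gauss formula for r_{ij}. *)
Definition Christoffel (r : R -> R -> E3) (i j k : idx) (x y : R) : R :=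
  / 2 * sum2 (fun l => gI_inv r k l x y *
    (pd i (gI r j l) x y + pd j (gI r i l) x y - pd l (gI r i j) x y)).

Definition direction (w : R -> E3) (h : R) : E3 := (/ vnorm (w h) *: w h)%V.

Definition is_rot_speed (w : R -> E3) (h s : R) : Prop :=
  exists d : E3, is_derive (direction w) h d /\ vnorm d = s.

Definition is_rot_speed_0 (w : R -> E3) (s : R) : Prop :=
  exists e0 d : E3,
    filterlim (direction w) (at_right 0) (locally e0) /\
    filterlim (fun h => (/ h *: (direction w h - e0))%V)
      (at_right 0) (locally d) /\
    vnorm d = s.

(* Main.v *)
(* The coefficients chi_k are the inner products of PQ with the frame dual to (r_1, r_2, n).
   For w = p e + q f the derivative of w/|w| is (|w|^2 w' - (w . w') w)/|w|^3, which gives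
   the speeds at positive times. At 0, w has the same direction as w(h)/h, which extends
   differentiably to h = 0 with value w'(0) and derivative w''(0)/2; so the limiting speed is
   the same formula evaluated there. Finally w'(0) and w''(0) are read off from the Gauss
   formula for the second derivatives of r. *)
Require Import Defs.
From Stdlib Require Import Reals Lra.
From Coquelicot Require Import Coquelicot.
Open Scope R_scope.

(** The obstacle is that [chi1], [chi2], [chi3] are arbitrary functions constrained only for times
    in (0, [delta]): nothing is known of them at 0, and their differentiability has to be proved.
    All analysis is therefore carried out on the scalar functions [dot (PQ h) d] with [d] a fixed
    vector. These are differentiable on both sides of 0, because the parameter interval is open, and
    for a suitable [d] they agree with the coefficients at small positive times. The limiting
    formula requires w'(0) to be nonzero. For the tangential projection w'(0) is the velocity of the
    curve, which cannot vanish since it is a factor of the nonzero triple product; for the other two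
    it is a multiple of r_1 or r_2, nonzero by the assumption on du^1/dt or du^2/dt. The vectors e
    and f are not supposed orthogonal, so that one computation serves the oblique pair (r_1, r_2)
    and the orthogonal pairs (r_k, n). *)

Lemma vec_ext (v w : E3) : cx v = cx w -> cy v = cy w -> cz v = cz w -> v = w.
Proof.
destruct v as [[a b] c], w as [[a' b'] c']; unfold cx, cy, cz; simpl.
now intros -> -> ->.
Qed.

Lemma cx_plus v w : cx (v + w)%V = cx v + cx w. Proof. reflexivity. Qed.
Lemma cy_plus v w : cy (v + w)%V = cy v + cy w. Proof. reflexivity. Qed.
Lemma cz_plus v w : cz (v + w)%V = cz v + cz w. Proof. reflexivity. Qed.
Lemma cx_minus v w : cx (v - w)%V = cx v - cx w. Proof. reflexivity. Qed.
Lemma cy_minus v w : cy (v - w)%V = cy v - cy w. Proof. reflexivity. Qed.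
Lemma cz_minus v w : cz (v - w)%V = cz v - cz w. Proof. reflexivity. Qed.
Lemma cx_scal a v : cx (a *: v)%V = a * cx v. Proof. reflexivity. Qed.
Lemma cy_scal a v : cy (a *: v)%V = a * cy v. Proof. reflexivity. Qed.
Lemma cz_scal a v : cz (a *: v)%V = a * cz v. Proof. reflexivity. Qed.
Lemma cx_vec a b c : cx (vec a b c) = a. Proof. reflexivity. Qed.
Lemma cy_vec a b c : cy (vec a b c) = b. Proof. reflexivity. Qed.
Lemma cz_vec a b c : cz (vec a b c) = c. Proof. reflexivity. Qed.
Lemma cx_0 : cx 0%V = 0. Proof. reflexivity. Qed.
Lemma cy_0 : cy 0%V = 0. Proof. reflexivity. Qed.
Lemma cz_0 : cz 0%V = 0. Proof. reflexivity. Qed.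

#[local] Hint Rewrite cx_plus cy_plus cz_plus cx_minus cy_minus cz_minus cx_scal cy_scal
  cz_scal cx_vec cy_vec cz_vec cx_0 cy_0 cz_0 : coords.

(* [ring] and [field] do not see through the canonical structures over [R]. *)
Ltac real_eq := try match goal with |- @eq _ ?a ?b => change (@eq R a b) end.
Ltac coords := unfold dot, cross; autorewrite with coords; real_eq.
Ltac vring := apply vec_ext; coords; ring.
Ltac vfield := apply vec_ext; coords; field.

Lemma dot_pos (v : E3) : v <> 0%V -> 0 < dot v v.
Proof.
intros hv; destruct (Rle_or_lt (dot v v) 0) as [h|h]; [|exact h].
exfalso; apply hv; unfold dot in h.
apply vec_ext; coords; nra.
Qed.

Lemma vnorm_pos (v : E3) : v <> 0%V -> 0 < vnorm v.
Proof. intros hv; rewrite norm_E3; now apply sqrt_lt_R0, dot_pos. Qed.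

Lemma vnorm_sqr (v : E3) : vnorm v ^ 2 = dot v v.
Proof.
rewrite norm_E3; apply pow2_sqrt; unfold dot; nra.
Qed.

Lemma vnorm_scal (a : R) (v : E3) : vnorm (a *: v)%V = Rabs a * vnorm v.
Proof.
rewrite !norm_E3, <- sqrt_Rsqr_abs, <- sqrt_mult_alt by apply Rle_0_sqr.
f_equal; unfold Rsqr; coords; ring.
Qed.

(* Eta-expanded as in the side conditions produced by [auto_derive]. *)
Lemma Derive_eta (f : R -> R) (x l : R) :
  is_derive f x l -> Derive (fun z : R => f z) x = l.
Proof. apply is_derive_unique. Qed.

(** * Rotational speed of a combination of two fixed vectors *)

(* [|w|^3] times the derivative of the direction of [w = p e + q f], that is,
   [|w|^2 w' - (w . w') w]. *)
Definition turn (p q p' q' : R) (e f : E3) : E3 :=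
  (((p' * q - p * q') * (p * dot e f + q * dot f f)) *: e
   - ((p' * q - p * q') * (p * dot e e + q * dot e f)) *: f)%V.

(** The direction is (p/|w|) e + (q/|w|) f, so only scalar quotients have to be differentiated.
    After expansion of the scalar products, the terms in p p' and q q' that do not contain p' q - p
    q' cancel, which leaves this determinant as common factor in [turn]. *)
Lemma is_rot_speed_turn (p q : R -> R) (e f : E3) (h p' q' : R) :
  is_derive p h p' -> is_derive q h q' ->
  (p h *: e + q h *: f <> 0)%V ->
  is_rot_speed (fun z => p z *: e + q z *: f)%V h
    (/ vnorm (p h *: e + q h *: f)%V ^ 3 * vnorm (turn (p h) (q h) p' q' e f)).
Proof.
intros hp hq hw; set (w := fun z => (p z *: e + q z *: f)%V).
assert (hN := vnorm_pos _ hw); assert (hN2 := vnorm_sqr (w h)).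
fold (w h) in hN |- *; set (N := vnorm (w h)) in *.
exists (/ N ^ 3 *: turn (p h) (q h) p' q' e f)%V; split.
2: { rewrite vnorm_scal, Rabs_pos_eq; [easy|].
     apply Rlt_le, Rinv_0_lt_compat; now apply pow_lt. }
set (S := fun z => dot (w z) (w z)).
assert (hS : is_derive S h (2 * dot (w h) (p' *: e + q' *: f)%V)).
{ apply (is_derive_ext (fun z => p z * p z * dot e e + 2 * (p z * q z) * dot e f
                         + q z * q z * dot f f)).
  { intros z; unfold S, w; coords; ring. }
  auto_derive; [repeat split; eexists; eassumption|].
  rewrite (Derive_eta p _ _ hp), (Derive_eta q _ _ hq).
  unfold w; coords; ring. }
assert (hSpos : 0 < S h) by now apply dot_pos.
assert (hsq : sqrt (S h) = N) by (unfold N; now rewrite norm_E3).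
(* The quotient rule for c/|w|, used with c = p and with c = q. *)
assert (hc : forall (c : R -> R) c', is_derive c h c' ->
  is_derive (fun z => / sqrt (S z) * c z) h
    (c' / N - c h * dot (w h) (p' *: e + q' *: f)%V / N ^ 3)).
{ intros c c' hc; auto_derive.
  { repeat split; [eexists; eassumption | easy | rewrite hsq; lra | eexists; eassumption]. }
  rewrite (Derive_eta S _ _ hS), (Derive_eta c _ _ hc), hsq.
  field; lra. }
assert (hd := is_derive_plus _ _ _ _ _
  (is_derive_scal_l _ _ _ e (hc p p' hp)) (is_derive_scal_l _ _ _ f (hc q q' hq))).
match type of hd with is_derive _ _ ?d =>
  replace d with (/ N ^ 3 *: turn (p h) (q h) p' q' e f)%V in hd end.
- refine (is_derive_ext _ _ _ _ _ hd).
  intros z; unfold direction; rewrite norm_E3; unfold S, w; vring.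
- unfold turn.
  assert (E : forall c c', c' / N - c * dot (w h) (p' *: e + q' *: f)%V / N ^ 3
     = / N ^ 3 * (c' * dot (w h) (w h) - c * dot (w h) (p' *: e + q' *: f)%V)).
  { intros; rewrite <- hN2; field; lra. }
  rewrite !E; unfold w; vring.
Qed.

(** The value of [w] at 0 does not enter: [direction V 0] serves as the limit direction, and the
    two-sided derivative of [direction V] at 0 is restricted to positive times. *)
Lemma is_rot_speed_0_ext (w V : R -> E3) (s : R) :
  at_right 0 (fun h => direction w h = direction V h) ->
  is_rot_speed V 0 s -> is_rot_speed_0 w s.
Proof.
intros hwV [d [hd hs]].
exists (direction V 0), d; split; [|split; [|exact hs]].
- apply filterlim_ext_loc with (1 := filter_imp _ _ (fun h H => eq_sym H) hwV).
  apply filterlim_filter_le_1 with (2 := ex_derive_continuous _ _ (ex_intro _ d hd)).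
  intros P HP; apply filter_le_within, HP.
- apply filterlim_locally_ball_norm; intros eps.
  destruct hd as [_ hd].
  (* The estimate contained in the derivative is a weak inequality, the ball is strict; halving
     [eps] bridges the two. *)
  assert (He : 0 < eps / 2) by (destruct eps; simpl; lra).
  specialize (hd 0 (fun P HP => HP) (mkposreal _ He)); simpl in hd.
  assert (H : at_right 0 (fun h : R =>
     norm (minus (minus (direction V h) (direction V 0)) (scal (minus h 0) d))
        <= eps / 2 * norm (minus h 0))) by (apply filter_le_within, hd).
  assert (Hp : at_right 0 (fun h : R => 0 < h)) by (exists (mkposreal 1 Rlt_0_1); easy).
  generalize (filter_and _ _ hwV (filter_and _ _ H Hp)); apply filter_imp.
  intros h [E [Hh hpos]]; rewrite E; red.
  change (norm (minus h 0)) with (Rabs (h - 0)) in Hh.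
  change (@minus R_AbsRing h 0) with (h - 0) in Hh.
  change (vnorm (direction V h - direction V 0 - (h - 0) *: d)%V <= eps / 2 * Rabs (h - 0)) in Hh.
  change (vnorm (/ h *: (direction V h - direction V 0) - d)%V < eps).
  replace (/ h *: (direction V h - direction V 0) - d)%V
    with (/ h *: (direction V h - direction V 0 - (h - 0) *: d))%V by (vfield; lra).
  rewrite Rminus_0_r, (Rabs_pos_eq h) in Hh by lra.
  rewrite vnorm_scal, Rabs_pos_eq by (apply Rlt_le, Rinv_0_lt_compat; lra).
  apply Rle_lt_trans with (eps / 2); [|lra].
  apply Rmult_le_reg_l with h; [easy|].
  rewrite <- Rmult_assoc, Rinv_r, Rmult_1_l by lra.
  rewrite Rminus_0_r; lra.
Qed.

(** Second-order Taylor expansion at 0 under mere differentiability of [f1] at 0: the remainder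
    [psi] has derivative o(z), so the mean value theorem gives psi(h) = o(h^2), and division by h^2
    gives the claim. *)
Lemma is_derive_dquot (f f1 : R -> R) (f2 : R) :
  locally 0 (fun h => is_derive f h (f1 h)) -> is_derive f1 0 f2 -> f 0 = 0 ->
  is_derive (fun h => if Req_dec_T h 0 then f1 0 else f h / h) 0 (f2 / 2).
Proof.
intros hf hf1 f0.
apply is_derive_Reals; intros eps heps.
apply is_derive_Reals in hf1; destruct (hf1 (eps / 2)) as [d1 hd1]; [lra|].
destruct hf as [d2 hd2].
exists (mkposreal _ (Rmin_stable_in_posreal d1 d2)); simpl; intros h hn hh.
rewrite Rplus_0_l.
destruct (Req_dec_T h 0) as [|_]; [easy|].
destruct (Req_dec_T 0 0) as [_|]; [|easy].
set (psi := fun z => f z - z * f1 0 - z ^ 2 / 2 * f2).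
assert (hh1 := Rlt_le_trans _ _ _ hh (Rmin_l _ _)).
assert (hh2 := Rlt_le_trans _ _ _ hh (Rmin_r _ _)).
assert (hpsi : forall z, Rmin 0 h <= z <= Rmax 0 h ->
   is_derive psi z (f1 z - f1 0 - z * f2)).
{ intros z hz.
  assert (hb : is_derive f z (f1 z)).
  { apply hd2; change (Rabs (z - 0) < d2).
    revert hz hh2; unfold Rmin, Rmax; destruct (Rle_dec 0 h); unfold Rabs;
      do 2 destruct Rcase_abs; lra. }
  unfold psi; auto_derive; [now exists (f1 z)|].
  rewrite (Derive_eta f _ _ hb); field. }
destruct (MVT_gen psi 0 h (fun z => f1 z - f1 0 - z * f2)) as [c [hc Ec]].
{ intros z hz; apply hpsi; lra. }
{ intros z hz; apply continuity_pt_filterlim, (ex_derive_continuous psi).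
  eexists; now apply hpsi. }
assert (hch : Rabs c <= Rabs h).
{ revert hc; unfold Rmin, Rmax; destruct (Rle_dec 0 h); unfold Rabs;
    do 2 destruct Rcase_abs; lra. }
assert (hb : Rabs (f1 c - f1 0 - c * f2) <= eps / 2 * Rabs h).
(* The intermediate point may be the endpoint 0, where the difference quotient of [f1] cannot be
   formed. *)
{ destruct (Req_dec c 0) as [->|hc0].
  - replace (f1 0 - f1 0 - 0 * f2) with 0 by ring; rewrite Rabs_R0.
    apply Rmult_le_pos; [lra|apply Rabs_pos].
  - assert (Hc := hd1 c hc0 (Rle_lt_trans _ _ _ hch hh1)); rewrite Rplus_0_l in Hc.
    replace (f1 c - f1 0 - c * f2) with (((f1 c - f1 0) / c - f2) * c) by now field.
    rewrite Rabs_mult; apply Rmult_le_compat; try apply Rabs_pos; lra. }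
replace ((f h / h - f1 0) / h - f2 / 2) with ((f1 c - f1 0 - c * f2) / h).
- rewrite Rabs_div by easy.
  apply Rle_lt_trans with (eps / 2); [|lra].
  apply Rmult_le_reg_r with (Rabs h); [now apply Rabs_pos_lt|].
  unfold Rdiv at 1; rewrite Rmult_assoc, Rinv_l, Rmult_1_r by now apply Rabs_no_R0.
  exact hb.
- unfold psi in Ec; rewrite f0 in Ec.
  apply Rmult_eq_reg_r with (h - 0); [|lra].
  unfold Rdiv at 1; rewrite Rmult_assoc, (Rmult_comm (/ h)), <- Rmult_assoc, <- Ec.
  field; easy.
Qed.

(** The factor 1/2 arises because [turn] is linear in its two derivative arguments, and the
    derivatives at 0 of p(h)/h and q(h)/h are half the second derivatives of p and q. *)
Lemma is_rot_speed_0_turn (p q p1 q1 : R -> R) (p2 q2 : R) (e f : E3) (w : R -> E3) :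
  p 0 = 0 -> q 0 = 0 ->
  locally 0 (fun h => is_derive p h (p1 h)) -> locally 0 (fun h => is_derive q h (q1 h)) ->
  is_derive p1 0 p2 -> is_derive q1 0 q2 ->
  (p1 0 *: e + q1 0 *: f <> 0)%V ->
  at_right 0 (fun h => w h = (p h *: e + q h *: f)%V) ->
  is_rot_speed_0 w (1 / 2 * / vnorm (p1 0%R *: e + q1 0%R *: f)%V ^ 3 *
    vnorm (turn (p1 0) (q1 0) p2 q2 e f)).
Proof.
intros p0 q0 hp hq hp1 hq1 ha hw.
set (P := fun h => if Req_dec_T h 0 then p1 0 else p h / h).
set (Q := fun h => if Req_dec_T h 0 then q1 0 else q h / h).
assert (P0 : P 0 = p1 0) by (unfold P; now destruct (Req_dec_T 0 0)).
assert (Q0 : Q 0 = q1 0) by (unfold Q; now destruct (Req_dec_T 0 0)).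
apply is_rot_speed_0_ext with (V := fun h => (P h *: e + Q h *: f)%V).
- assert (Hp : at_right 0 (fun h : R => 0 < h)) by (exists (mkposreal 1 Rlt_0_1); easy).
  generalize (filter_and _ _ hw Hp); apply filter_imp; intros h [E hpos].
  unfold direction; rewrite E; unfold P, Q; destruct (Req_dec_T h 0); [lra|].
  (* A positive factor h does not change the direction. *)
  replace (p h *: e + q h *: f)%V with (h *: ((p h / h) *: e + (q h / h) *: f))%V
    by now vfield.
  rewrite vnorm_scal, Rabs_pos_eq, Rinv_mult by lra.
  generalize (/ vnorm ((p h / h) *: e + (q h / h) *: f)%V); intros k; now vfield.
- rewrite <- P0, <- Q0 in ha |- *.
  replace (1 / 2 * / vnorm (P 0%R *: e + Q 0%R *: f)%V ^ 3
             * vnorm (turn (P 0) (Q 0) p2 q2 e f))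
    with (/ vnorm (P 0%R *: e + Q 0%R *: f)%V ^ 3
             * vnorm (turn (P 0) (Q 0) (p2 / 2) (q2 / 2) e f)).
  + apply (is_rot_speed_turn P Q); [| |exact ha]; now apply is_derive_dquot.
  + replace (turn (P 0) (Q 0) (p2 / 2) (q2 / 2) e f)
      with (1 / 2 *: turn (P 0%R) (Q 0%R) p2 q2 e f)%V by (unfold turn; vfield).
    rewrite vnorm_scal, (Rabs_pos_eq (1 / 2)) by lra; ring.
Qed.

(** * Partial derivatives and the chain rule along a curve *)

Lemma ex_diff_n_pd (F : R -> R -> R) (n : nat) (i : idx) (x y : R) :
  ex_diff_n F (S n) x y -> ex_diff_n (pd i F) n x y.
Proof. intros (_ & _ & _ & H1 & H2); now destruct i. Qed.

(** The classical criterion: one partial derivative exists near the point and is continuous there,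
    the other exists at the point. *)
Lemma differentiable_pt_lim_pd (F : R -> R -> R) (x y : R) :
  locally (x, y) (fun z => ex_diff_n F 1 (fst z) (snd z)) ->
  differentiable_pt_lim F x y (pd I1 F x y) (pd I2 F x y).
Proof.
intros HF; apply filterdiff_differentiable_pt_lim.
assert (H0 := locally_singleton _ _ HF); simpl fst in H0; simpl snd in H0.
apply (is_derive_filterdiff F x y (pd I1 F)).
- revert HF; apply filter_imp; intros z (_ & H & _); now apply Derive_correct.
- destruct H0 as (_ & _ & H & _); now apply Derive_correct.
- destruct H0 as (_ & _ & _ & [H _] & _).
  now apply continuity_2d_pt_filterlim in H.
Qed.

Lemma pd_comm (F : R -> R -> R) (x y : R) :
  locally (x, y) (fun z => ex_diff_n F 2 (fst z) (snd z)) ->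
  pd I2 (pd I1 F) x y = pd I1 (pd I2 F) x y.
Proof.
intros HF; assert (H0 := locally_singleton _ _ HF); simpl fst in H0; simpl snd in H0.
symmetry; apply (Schwarz F).
- apply locally_2d_locally; revert HF; apply filter_imp; intros [a b] H.
  destruct H as (_ & H1 & H2 & (_ & _ & H3 & _) & (_ & H4 & _)); now repeat split.
- destruct H0 as (_ & _ & _ & _ & (_ & _ & _ & [H _] & _)); exact H.
- destruct H0 as (_ & _ & _ & (_ & _ & _ & _ & [H _]) & _); exact H.
Qed.

Lemma is_derive_comp_pd (F : R -> R -> R) (v1 v2 : R -> R) (s l1 l2 : R) :
  locally (v1 s, v2 s) (fun z => ex_diff_n F 1 (fst z) (snd z)) ->
  is_derive v1 s l1 -> is_derive v2 s l2 ->
  is_derive (fun z => F (v1 z) (v2 z)) s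
    (pd I1 F (v1 s) (v2 s) * l1 + pd I2 F (v1 s) (v2 s) * l2).
Proof.
intros HF H1 H2; apply is_derive_Reals.
apply derivable_pt_lim_comp_2d; [now apply differentiable_pt_lim_pd| |];
  now apply is_derive_Reals.
Qed.

Definition curve_d1 (F : R -> R -> R) (u : idx -> R -> R) (s : R) : R :=
  sum2 (fun i => pd i F (u I1 s) (u I2 s) * Derive (u i) s).

Definition curve_d2 (F : R -> R -> R) (u : idx -> R -> R) (s : R) : R :=
  sum2 (fun i => sum2 (fun j =>
      pd j (pd i F) (u I1 s) (u I2 s) * Derive (u i) s * Derive (u j) s)
    + pd i F (u I1 s) (u I2 s) * Derive_n (u i) 2 s).

Lemma is_derive_curve (F : R -> R -> R) (u : idx -> R -> R) (s : R) :
  locally (u I1 s, u I2 s) (fun z => ex_diff_n F 1 (fst z) (snd z)) ->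
  (forall i, ex_derive (u i) s) ->
  is_derive (fun z => F (u I1 z) (u I2 z)) s (curve_d1 F u s).
Proof.
intros HF Hu; apply is_derive_comp_pd; [easy| |]; apply Derive_correct, Hu.
Qed.

Lemma is_derive_curve_d1 (F : R -> R -> R) (u : idx -> R -> R) (s : R) :
  locally (u I1 s, u I2 s) (fun z => ex_diff_n F 2 (fst z) (snd z)) ->
  (forall i, ex_derive (u i) s) -> (forall i, ex_derive (Derive (u i)) s) ->
  is_derive (curve_d1 F u) s (curve_d2 F u s).
Proof.
intros HF Hu Hu2.
assert (H : forall i, is_derive (fun z => pd i F (u I1 z) (u I2 z) * Derive (u i) z) s
   (sum2 (fun j =>
      pd j (pd i F) (u I1 s) (u I2 s) * Derive (u i) s * Derive (u j) s)
    + pd i F (u I1 s) (u I2 s) * Derive_n (u i) 2 s)).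
{ intros i.
  assert (Hi : locally (u I1 s, u I2 s) (fun z => ex_diff_n (pd i F) 1 (fst z) (snd z))).
  { revert HF; apply filter_imp; intros z; apply ex_diff_n_pd. }
  assert (A := is_derive_curve _ _ _ Hi Hu).
  assert (B := Derive_correct _ _ (Hu2 i)).
  assert (M := is_derive_mult _ _ _ _ _ A B Rmult_comm).
  refine (eq_rect _ (fun l => is_derive _ s l) M _ _).
  change (Derive_n (u i) 2 s) with (Derive (Derive (u i)) s).
  unfold curve_d1, sum2, plus, mult; simpl; ring. }
exact (is_derive_plus _ _ _ _ _ (H I1) (H I2)).
Qed.

Definition ex_diff_v (V : R -> R -> E3) (n : nat) (x y : R) : Prop :=
  ex_diff_n (fun a b => cx (V a b)) n x y /\
  ex_diff_n (fun a b => cy (V a b)) n x y /\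
  ex_diff_n (fun a b => cz (V a b)) n x y.

Lemma ex_diff_v_m (V : R -> R -> E3) (m n : nat) (x y : R) :
  (m <= n)%nat -> ex_diff_v V n x y -> ex_diff_v V m x y.
Proof. intros H (A & B & C); repeat split; now apply ex_diff_n_m with n. Qed.

Lemma ex_diff_v_vpd (V : R -> R -> E3) (n : nat) (i : idx) (x y : R) :
  ex_diff_v V (S n) x y -> ex_diff_v (vpd i V) n x y.
Proof.
intros (A & B & C).
exact (conj (ex_diff_n_pd _ _ i _ _ A)
  (conj (ex_diff_n_pd _ _ i _ _ B) (ex_diff_n_pd _ _ i _ _ C))).
Qed.

Lemma is_derive_dot (V W : R -> E3) (s : R) (v w : E3) :
  is_derive (fun z => cx (V z)) s (cx v) -> is_derive (fun z => cy (V z)) s (cy v) ->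
  is_derive (fun z => cz (V z)) s (cz v) ->
  is_derive (fun z => cx (W z)) s (cx w) -> is_derive (fun z => cy (W z)) s (cy w) ->
  is_derive (fun z => cz (W z)) s (cz w) ->
  is_derive (fun z => dot (V z) (W z)) s (dot v (W s) + dot (V s) w).
Proof.
intros V1 V2 V3 W1 W2 W3.
assert (D := is_derive_plus _ _ _ _ _ (is_derive_plus _ _ _ _ _
  (is_derive_mult _ _ _ _ _ V1 W1 Rmult_comm) (is_derive_mult _ _ _ _ _ V2 W2 Rmult_comm))
  (is_derive_mult _ _ _ _ _ V3 W3 Rmult_comm)).
refine (eq_rect _ (fun l => is_derive _ s l) D _ _).
unfold plus, mult; simpl; coords; ring.
Qed.

Lemma pd_dot (V W : R -> R -> E3) (i : idx) (x y : R) :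
  ex_diff_v V 1 x y -> ex_diff_v W 1 x y ->
  pd i (fun a b => dot (V a b) (W a b)) x y
  = dot (vpd i V x y) (W x y) + dot (V x y) (vpd i W x y).
Proof.
intros ((_ & V1 & V2 & _) & (_ & V3 & V4 & _) & (_ & V5 & V6 & _))
  ((_ & W1 & W2 & _) & (_ & W3 & W4 & _) & (_ & W5 & W6 & _)).
destruct i; apply is_derive_unique.
- apply (is_derive_dot (fun z => V z y) (fun z => W z y)); now apply Derive_correct.
- apply (is_derive_dot (V x) (W x)); now apply Derive_correct.
Qed.

Lemma vpd_comm (V : R -> R -> E3) (x y : R) :
  locally (x, y) (fun z => ex_diff_v V 2 (fst z) (snd z)) ->
  vpd I2 (vpd I1 V) x y = vpd I1 (vpd I2 V) x y.
Proof.
intros H; apply vec_ext;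
  [apply (pd_comm (fun a b => cx (V a b)))|apply (pd_comm (fun a b => cy (V a b)))
  |apply (pd_comm (fun a b => cz (V a b)))];
  revert H; apply filter_imp; now intros z (A & B & C).
Qed.

(** * The frame (r_1, r_2, n), its dual, and the Gauss formula *)

Lemma dot_comm (v w : E3) : dot v w = dot w v.
Proof. coords; ring. Qed.

Lemma gI_comm (r : R -> R -> E3) (i j : idx) (x y : R) : gI r i j x y = gI r j i x y.
Proof. apply dot_comm. Qed.

Lemma dot_scal_r (a : R) (v w : E3) : dot v (a *: w)%V = a * dot v w.
Proof. coords; ring. Qed.

Lemma dot_plus_r (u v w : E3) : dot u (v + w)%V = dot u v + dot u w.
Proof. coords; ring. Qed.

Lemma dot_scal_l (a : R) (v w : E3) : dot (a *: v)%V w = a * dot v w.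
Proof. coords; ring. Qed.

Lemma dot_plus_l (u v w : E3) : dot (u + v)%V w = dot u w + dot v w.
Proof. coords; ring. Qed.

(* The basis of the tangent plane dual to [r_1], [r_2]: [chi_k] is the inner product of [PQ]
   with it, and [Gamma_ij^k] that of [r_ij]. *)
Definition dual (r : R -> R -> E3) (k : idx) (x y : R) : E3 :=
  vsum2 (fun l => gI_inv r k l x y *: vpd l r x y)%V.

(** Lagrange's identity. On a regular net it makes the determinant positive, so that the divisions
    in [gI_inv] are genuine. *)
Lemma gI_det (r : R -> R -> E3) (x y : R) :
  let c := cross (vpd I1 r x y) (vpd I2 r x y) in
  gI r I1 I1 x y * gI r I2 I2 x y - gI r I1 I2 x y ^ 2 = dot c c.
Proof. intros c; unfold c, gI; coords; ring. Qed.

Lemma dot_dual (r : R -> R -> E3) (k l : idx) (x y : R) :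
  cross (vpd I1 r x y) (vpd I2 r x y) <> 0%V ->
  dot (vpd l r x y) (dual r k x y)
  = match k, l with I1, I1 | I2, I2 => 1 | _, _ => 0 end.
Proof.
intros H; apply dot_pos in H; rewrite <- gI_det in H.
unfold dual, vsum2; rewrite dot_plus_r, !dot_scal_r.
fold (gI r l I1 x y) (gI r l I2 x y).
unfold gI_inv; destruct k, l; rewrite ?(gI_comm r I2 I1); field; lra.
Qed.

Lemma dot_unit_normal (r : R -> R -> E3) (l : idx) (x y : R) :
  dot (vpd l r x y) (unit_normal r x y) = 0.
Proof. unfold unit_normal; rewrite dot_scal_r; destruct l; coords; ring. Qed.

Lemma dot_unit_normal_dual (r : R -> R -> E3) (k : idx) (x y : R) :
  dot (unit_normal r x y) (dual r k x y) = 0.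
Proof.
unfold dual, vsum2; rewrite dot_plus_r, !dot_scal_r, !(dot_comm (unit_normal _ _ _)).
rewrite !dot_unit_normal; ring.
Qed.

Lemma unit_normal_sqr (r : R -> R -> E3) (x y : R) :
  cross (vpd I1 r x y) (vpd I2 r x y) <> 0%V ->
  dot (unit_normal r x y) (unit_normal r x y) = 1.
Proof.
intros H; unfold unit_normal; rewrite dot_scal_r, dot_scal_l, <- vnorm_sqr.
apply vnorm_pos in H; field; lra.
Qed.

(** The product rule turns the three derivatives of the metric into six terms of the form r_ab .
    r_c; by symmetry of second derivatives four of them cancel and 2 r_ij . r_l remains. *)
Lemma Christoffel_dual (r : R -> R -> E3) (i j k : idx) (x y : R) :
  locally (x, y) (fun z => ex_diff_v r 2 (fst z) (snd z)) ->
  Christoffel r i j k x y = dot (vpd j (vpd i r) x y) (dual r k x y).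
Proof.
intros H; assert (C := vpd_comm r x y H).
assert (H1 : forall m, ex_diff_v (vpd m r) 1 x y).
{ intros m; apply ex_diff_v_vpd; exact (locally_singleton _ _ H). }
assert (E : forall a b c, pd a (gI r b c) x y
  = dot (vpd a (vpd b r) x y) (vpd c r x y) + dot (vpd b r x y) (vpd a (vpd c r) x y)).
{ intros a b c; now apply pd_dot. }
unfold Christoffel, dual, vsum2, sum2; rewrite !E, dot_plus_r, !dot_scal_r.
rewrite !(dot_comm (vpd _ r x y)).
destruct i, j; rewrite ?C; field.
Qed.

(** * Rotational speeds when the coefficients are scalar products with a moving vector *)

(** Near [h] the coefficients coincide with scalar products of [P], hence are differentiable; this
    makes the terms [Derive chia h] and [Derive chib h] true derivatives rather than default
    values. *)
Lemma is_rot_speed_projection (P P1 : R -> E3) (delta : R) (chia chib : R -> R)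
    (a b e f : E3) (h : R) :
  (forall d, is_derive (fun z => dot (P z) d) h (dot (P1 h) d)) ->
  (forall z, 0 < z < delta -> chia z = dot (P z) a) ->
  (forall z, 0 < z < delta -> chib z = dot (P z) b) ->
  0 < h < delta ->
  (chia h *: e + chib h *: f)%V <> 0%V ->
  is_rot_speed (fun z => chia z *: e + chib z *: f)%V h
    (/ vnorm (chia h *: e + chib h *: f)%V ^ 3 *
     vnorm (turn (chia h) (chib h) (Derive chia h) (Derive chib h) e f)).
Proof.
intros dP chiaE chibE hh hw.
assert (L : locally h (fun z => 0 < z < delta)).
{ apply filter_and; [apply (open_gt 0)|apply (open_lt delta)]; apply hh. }
assert (D : forall c d, (forall z, 0 < z < delta -> c z = dot (P z) d) ->
  is_derive c h (Derive c h)).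
{ intros c d Ec; apply Derive_correct; exists (dot (P1 h) d).
  apply is_derive_ext_loc with (2 := dP d).
  revert L; apply filter_imp; intros z hz; symmetry; now apply Ec. }
apply is_rot_speed_turn; [exact (D _ _ chiaE)|exact (D _ _ chibE)|exact hw].
Qed.

(** The scalar products with [P] continue the coefficients differentiably through 0, where the
    coefficients themselves are unconstrained. *)
Lemma is_rot_speed_0_projection (P P1 : R -> E3) (P2 : E3) (delta : R)
    (chia chib : R -> R) (a b e f : E3) :
  P 0 = 0%V -> 0 < delta ->
  locally 0 (fun h => forall d, is_derive (fun z => dot (P z) d) h (dot (P1 h) d)) ->
  (forall d, is_derive (fun z => dot (P1 z) d) 0 (dot P2 d)) ->
  (forall z, 0 < z < delta -> chia z = dot (P z) a) ->
  (forall z, 0 < z < delta -> chib z = dot (P z) b) ->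
  (dot (P1 0) a *: e + dot (P1 0) b *: f)%V <> 0%V ->
  is_rot_speed_0 (fun z => chia z *: e + chib z *: f)%V
    (1 / 2 * / vnorm (dot (P1 0%R) a *: e + dot (P1 0%R) b *: f)%V ^ 3 *
     vnorm (turn (dot (P1 0) a) (dot (P1 0) b) (dot P2 a) (dot P2 b) e f)).
Proof.
intros P_0 delta_pos dP_loc dP1 chiaE chibE hw.
apply (is_rot_speed_0_turn (fun z => dot (P z) a) (fun z => dot (P z) b)
  (fun z => dot (P1 z) a) (fun z => dot (P1 z) b)); try easy.
- rewrite P_0; coords; ring.
- rewrite P_0; coords; ring.
- revert dP_loc; now apply filter_imp.
- revert dP_loc; now apply filter_imp.
- exists (mkposreal _ delta_pos); simpl; intros h hh hpos.
  assert (H : 0 < h < delta).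
  { split; [exact hpos|].
    change (Rabs (h - 0) < delta) in hh; revert hh; unfold Rabs; destruct Rcase_abs; lra. }
  now rewrite chiaE, chibE.
Qed.

(** * Velocity and acceleration of the curve and their components *)

Definition curve_v1 (r : R -> R -> E3) (u : idx -> R -> R) (s : R) : E3 :=
  vsum2 (fun i => Derive (u i) s *: vpd i r (u I1 s) (u I2 s))%V.

Definition curve_v2 (r : R -> R -> E3) (u : idx -> R -> R) (s : R) : E3 :=
  vsum2 (fun i => vsum2 (fun j =>
      (Derive (u i) s * Derive (u j) s) *: vpd j (vpd i r) (u I1 s) (u I2 s))
    + Derive_n (u i) 2 s *: vpd i r (u I1 s) (u I2 s))%V.

Lemma is_derive_dot_l (V : R -> E3) (d : E3) (s : R) (l : E3) :
  is_derive (fun z => cx (V z)) s (cx l) -> is_derive (fun z => cy (V z)) s (cy l) ->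
  is_derive (fun z => cz (V z)) s (cz l) -> is_derive (fun z => dot (V z) d) s (dot l d).
Proof.
intros A B C.
assert (K : forall c : R, is_derive (fun _ => c) s 0) by (intros c; exact (@is_derive_const R_AbsRing R_NormedModule c s)).
assert (D := is_derive_dot V (fun _ => d) s l 0%V A B C (K _) (K _) (K _)).
replace (dot l d) with (dot l d + dot (V s) 0%V) by (coords; ring).
exact D.
Qed.


Lemma is_derive_curve_dot (r : R -> R -> E3) (u : idx -> R -> R) (p d : E3) (s : R) :
  locally (u I1 s, u I2 s) (fun z => ex_diff_v r 1 (fst z) (snd z)) ->
  (forall i, ex_derive (u i) s) ->
  is_derive (fun z => dot (r (u I1 z) (u I2 z) - p)%V d) s (dot (curve_v1 r u s) d).
Proof.
intros Hr Hu.
assert (K : forall F : R -> R -> R, forall c : R,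
  locally (u I1 s, u I2 s) (fun z => ex_diff_n F 1 (fst z) (snd z)) ->
  is_derive (fun z => F (u I1 z) (u I2 z) - c) s
    (Derive (u I1) s * pd I1 F (u I1 s) (u I2 s)
     + Derive (u I2) s * pd I2 F (u I1 s) (u I2 s))).
{ intros F c HF; assert (D := is_derive_curve F u s HF Hu).
  assert (D' := is_derive_minus _ _ _ _ _ D (@is_derive_const R_AbsRing R_NormedModule c s)).
  refine (eq_rect _ (fun l => is_derive _ s l) D' _ _).
  unfold curve_d1, sum2, minus, plus, opp, zero; simpl; real_eq; ring. }
apply is_derive_dot_l.
- apply (K (fun a b => cx (r a b)) (cx p)); revert Hr; apply filter_imp; now intros z (A & _).
- apply (K (fun a b => cy (r a b)) (cy p)); revert Hr; apply filter_imp; now intros z (_ & A & _).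
- apply (K (fun a b => cz (r a b)) (cz p)); revert Hr; apply filter_imp; now intros z (_ & _ & A).
Qed.

Lemma is_derive_curve_v1_dot (r : R -> R -> E3) (u : idx -> R -> R) (d : E3) (s : R) :
  locally (u I1 s, u I2 s) (fun z => ex_diff_v r 2 (fst z) (snd z)) ->
  (forall i, ex_derive (u i) s) -> (forall i, ex_derive (Derive (u i)) s) ->
  is_derive (fun z => dot (curve_v1 r u z) d) s (dot (curve_v2 r u s) d).
Proof.
intros Hr Hu Hu2.
assert (K : forall F : R -> R -> R,
  locally (u I1 s, u I2 s) (fun z => ex_diff_n F 2 (fst z) (snd z)) ->
  is_derive (fun z => Derive (u I1) z * pd I1 F (u I1 z) (u I2 z)
     + Derive (u I2) z * pd I2 F (u I1 z) (u I2 z)) s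
   (((Derive (u I1) s * Derive (u I1) s) * pd I1 (pd I1 F) (u I1 s) (u I2 s)
    + (Derive (u I1) s * Derive (u I2) s) * pd I2 (pd I1 F) (u I1 s) (u I2 s)
    + Derive_n (u I1) 2 s * pd I1 F (u I1 s) (u I2 s))
   + ((Derive (u I2) s * Derive (u I1) s) * pd I1 (pd I2 F) (u I1 s) (u I2 s)
    + (Derive (u I2) s * Derive (u I2) s) * pd I2 (pd I2 F) (u I1 s) (u I2 s)
    + Derive_n (u I2) 2 s * pd I2 F (u I1 s) (u I2 s)))).
{ intros F HF; assert (D := is_derive_curve_d1 F u s HF Hu Hu2).
  refine (eq_rect _ (fun l => is_derive _ s l) (is_derive_ext _ _ _ _ _ D) _ _).
  - intros z; unfold curve_d1, sum2; real_eq; ring.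
  - unfold curve_d2, sum2; real_eq; ring. }
apply is_derive_dot_l.
- apply (K (fun a b => cx (r a b))); revert Hr; apply filter_imp; now intros z (A & _).
- apply (K (fun a b => cy (r a b))); revert Hr; apply filter_imp; now intros z (_ & A & _).
- apply (K (fun a b => cz (r a b))); revert Hr; apply filter_imp; now intros z (_ & _ & A).
Qed.

Lemma is_derive_shift (f : R -> R) (t h l : R) :
  is_derive f (t + h) l -> is_derive (fun z => f (t + z)) h l.
Proof.
intros H; apply is_derive_Reals; apply is_derive_Reals in H.
intros eps heps; destruct (H eps heps) as [d Hd]; exists d; intros k.
rewrite <- Rplus_assoc; apply Hd.
Qed.

Lemma dot_curve_v1_dual (r : R -> R -> E3) (u : idx -> R -> R) (k : idx) (s : R) :
  cross (vpd I1 r (u I1 s) (u I2 s)) (vpd I2 r (u I1 s) (u I2 s)) <> 0%V ->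
  dot (curve_v1 r u s) (dual r k (u I1 s) (u I2 s)) = Derive (u k) s.
Proof.
intros reg; unfold curve_v1, vsum2.
rewrite dot_plus_l, !dot_scal_l, !dot_dual by easy.
destruct k; ring.
Qed.

Lemma dot_curve_v1_normal (r : R -> R -> E3) (u : idx -> R -> R) (s : R) :
  dot (curve_v1 r u s) (unit_normal r (u I1 s) (u I2 s)) = 0.
Proof.
unfold curve_v1, vsum2; rewrite dot_plus_l, !dot_scal_l, !dot_unit_normal; ring.
Qed.

(** The tangential part of the Gauss formula: the result is the k-th component of the covariant
    derivative of the velocity. *)
Lemma dot_curve_v2_dual (r : R -> R -> E3) (u : idx -> R -> R) (k : idx) (s : R) :
  cross (vpd I1 r (u I1 s) (u I2 s)) (vpd I2 r (u I1 s) (u I2 s)) <> 0%V ->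
  locally (u I1 s, u I2 s) (fun z => ex_diff_v r 2 (fst z) (snd z)) ->
  dot (curve_v2 r u s) (dual r k (u I1 s) (u I2 s))
  = sum2 (fun i => sum2 (fun j =>
      Christoffel r i j k (u I1 s) (u I2 s) * Derive (u i) s * Derive (u j) s))
    + Derive_n (u k) 2 s.
Proof.
intros reg H; unfold curve_v2, vsum2, sum2; rewrite !(Christoffel_dual r _ _ _ _ _ H).
rewrite !dot_plus_l, !dot_scal_l, !dot_dual by easy.
destruct k; ring.
Qed.

Lemma dot_curve_v2_normal (r : R -> R -> E3) (u : idx -> R -> R) (s : R) :
  dot (curve_v2 r u s) (unit_normal r (u I1 s) (u I2 s))
  = sum2 (fun i => sum2 (fun j =>
      LII r i j (u I1 s) (u I2 s) * Derive (u i) s * Derive (u j) s)).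
Proof.
unfold curve_v2, vsum2, sum2, LII.
rewrite !dot_plus_l, !dot_scal_l, !dot_unit_normal; ring.
Qed.

Lemma vnorm_lin2 (a b : R) (e f : E3) :
  vnorm (a *: e + b *: f)%V
  = sqrt (a ^ 2 * dot e e + 2 * a * b * dot e f + b ^ 2 * dot f f).
Proof. rewrite norm_E3; f_equal; coords; ring. Qed.

(* The case where the second frame vector is the unit normal and the curve is tangent
   to the surface: only the normal part of the acceleration turns the direction. *)
Lemma vnorm_turn_normal (p p2 q2 : R) (e n : E3) :
  dot e n = 0 -> dot n n = 1 -> (p *: e <> 0)%V ->
  1 / 2 * / vnorm (p *: e + 0%R *: n)%V ^ 3 * vnorm (turn p 0 p2 q2 e n)
  = 1 / 2 * / vnorm (p *: e)%V * Rabs q2.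
Proof.
intros en nn hp.
replace (p *: e + 0%R *: n)%V with (p *: e)%V by vring.
unfold turn; rewrite en, nn.
replace (_ - _)%V with ((q2 * dot (p *: e)%V (p *: e)%V) *: n)%V.
2: { rewrite dot_scal_l, dot_scal_r; vring. }
rewrite <- vnorm_sqr; apply vnorm_pos in hp.
rewrite (vnorm_scal _ n), Rabs_mult, (norm_E3 n), nn, sqrt_1,  (Rabs_pos_eq (_ ^ 2)) by (apply pow_le; lra).
field; lra.
Qed.

Lemma locally_in_itv (t0 t1 : Rbar) (t : R) :
  in_itv t0 t1 t -> locally 0 (fun h => in_itv t0 t1 (t + h)).
Proof.
intros [H0 H1].
destruct (filter_and _ _ (open_Rbar_gt t0 t H0) (open_Rbar_lt t1 t H1)) as [e He].
exists e; intros h Hh; apply He.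
change (Rabs (t + h - t) < e); change (Rabs (h - 0) < e) in Hh.
now replace (t + h - t) with (h - 0) by ring.
Qed.

(** Links the coordinatewise derivative in the nondegeneracy hypothesis to the chain-rule expression
    of the velocity. *)
Lemma vDerive_curve (r : R -> R -> E3) (u : idx -> R -> R) (s : R) :
  locally (u I1 s, u I2 s) (fun z => ex_diff_v r 1 (fst z) (snd z)) ->
  (forall i, ex_derive (u i) s) ->
  vDerive_n (fun z => r (u I1 z) (u I2 z)) 1 s = curve_v1 r u s.
Proof.
intros Hr Hu.
assert (K : forall F : R -> R -> R,
  locally (u I1 s, u I2 s) (fun z => ex_diff_n F 1 (fst z) (snd z)) ->
  Derive_n (fun z => F (u I1 z) (u I2 z)) 1 s
  = Derive (u I1) s * pd I1 F (u I1 s) (u I2 s)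
    + Derive (u I2) s * pd I2 F (u I1 s) (u I2 s)).
{ intros F HF; assert (D := is_derive_unique _ _ _ (is_derive_curve F u s HF Hu)).
  refine (eq_trans D _); unfold curve_d1, sum2; ring. }
apply vec_ext.
- apply (K (fun a b => cx (r a b))); revert Hr; apply filter_imp; now intros z (A & _).
- apply (K (fun a b => cy (r a b))); revert Hr; apply filter_imp; now intros z (_ & A & _).
- apply (K (fun a b => cz (r a b))); revert Hr; apply filter_imp; now intros z (_ & _ & A).
Qed.

Theorem proposition4p3
  (U : R * R -> Prop) (r : R -> R -> E3)
  (U_open : open U)
  (r_C3 : C3_surface U r)
  (r_regular : forall x y : R, U (x, y) ->
     cross (vpd I1 r x y) (vpd I2 r x y) <> 0%V)
  (u : idx -> R -> R) (t0 t1 : Rbar)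
  (u_C3 : forall i : idx, C3_on t0 t1 (u i))
  (u_in_U : forall s : R, in_itv t0 t1 s -> U (u I1 s, u I2 s))
  (curve_nondeg : forall s : R, in_itv t0 t1 s ->
     let rho := fun z : R => r (u I1 z) (u I2 z) in
     dot (cross (vDerive_n rho 1 s) (vDerive_n rho 2 s)) (vDerive_n rho 3 s)
       <> 0)
  (t : R) (t_in : in_itv t0 t1 t)
  (delta : R) (delta_pos : 0 < delta) (delta_small : Rbar_le (t + delta) t1)
  (chi1 chi2 chi3 : R -> R) :
  let x := u I1 t in
  let y := u I2 t in
  let r_ := fun i : idx => vpd i r x y in
  let n := unit_normal r x y in
  let g := fun i j : idx => gI r i j x y in
  let L := fun i j : idx => LII r i j x y in
  let Gamma := fun i j k : idx => Christoffel r i j k x y in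
  let du := fun i : idx => Derive (u i) t in
  let ddu := fun i : idx => Derive_n (u i) 2 t in
  let PQ := fun h : R => (r (u I1 (t + h)%R) (u I2 (t + h)%R) - r x y)%V in
  let PQA := fun h : R => (chi1 h *: r_ I1 + chi2 h *: r_ I2)%V in
  let PQB := fun h : R => (chi1 h *: r_ I1 + chi3 h *: n)%V in
  let PQC := fun h : R => (chi2 h *: r_ I2 + chi3 h *: n)%V in
  let C := fun p : idx =>
    sum2 (fun k => sum2 (fun l =>
      (sum2 (fun i => sum2 (fun j => Gamma i j l * du i * du j * du k * du p))
       + ddu l * du k * du p
       - sum2 (fun i => sum2 (fun j => Gamma i j p * du i * du j * du k * du l))
       - ddu p * du k * du l) * g k l)) in
  (forall h : R, 0 < h < delta ->
     PQ h = (chi1 h *: r_ I1 + chi2 h *: r_ I2 + chi3 h *: n)%V) ->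
  (forall h : R, 0 < h < delta -> PQA h <> 0%V /\ PQB h <> 0%V /\ PQC h <> 0%V) ->
  ((forall h : R, 0 < h < delta ->
      let c1 := chi1 h in let c2 := chi2 h in
      let c1' := Derive chi1 h in let c2' := Derive chi2 h in
      is_rot_speed PQA h
        (/ vnorm (c1 *: r_ I1 + c2 *: r_ I2)%V ^ 3 *
         vnorm ((c1 ^ 2 * c2' * g I1 I2) *: r_ I1
              + (c2 * c2' * c1 * g I2 I2) *: r_ I1
              - (c1 * c2 * c1' * g I1 I2) *: r_ I1
              - (c2 ^ 2 * c1' * g I2 I2) *: r_ I1
              + (c1 * c1' * c2 * g I1 I1) *: r_ I2
              + (c2 ^ 2 * c1' * g I1 I2) *: r_ I2
              - (c1 ^ 2 * c2' * g I1 I1) *: r_ I2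
              - (c1 * c2 * c2' * g I1 I2) *: r_ I2)%V)) /\
   is_rot_speed_0 PQA
     (1 / 2 * / vnorm (vsum2 (fun k => (du k *: r_ k)%V)) ^ 3 *
      sqrt (sum2 (fun p => sum2 (fun q => C p * C q * g p q))))) /\
  ((forall h : R, 0 < h < delta ->
      let c1 := chi1 h in let c3 := chi3 h in
      let c1' := Derive chi1 h in let c3' := Derive chi3 h in
      is_rot_speed PQB h
        (/ vnorm (c1 *: r_ I1 + c3 *: n)%V ^ 3 *
         vnorm ((c3 * c3' * c1) *: r_ I1
              - (c3 ^ 2 * c1') *: r_ I1
              + (c1 * c1' * c3 * g I1 I1) *: n
              - (c1 ^ 2 * c3' * g I1 I1) *: n)%V)) /\
   (du I1 <> 0 ->
    is_rot_speed_0 PQB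
      (1 / 2 * / vnorm (du I1 *: r_ I1)%V *
       Rabs (sum2 (fun i => sum2 (fun j => L i j * du i * du j)))))) /\
  ((forall h : R, 0 < h < delta ->
      let c2 := chi2 h in let c3 := chi3 h in
      let c2' := Derive chi2 h in let c3' := Derive chi3 h in
      is_rot_speed PQC h
        (/ vnorm (c2 *: r_ I2 + c3 *: n)%V ^ 3 *
         vnorm ((c3 * c3' * c2) *: r_ I2
              - (c3 ^ 2 * c2') *: r_ I2
              + (c2 * c2' * c3 * g I2 I2) *: n
              - (c2 ^ 2 * c3' * g I2 I2) *: n)%V)) /\
   (du I2 <> 0 ->
    is_rot_speed_0 PQC
      (1 / 2 * / vnorm (du I2 *: r_ I2)%V *
       Rabs (sum2 (fun i => sum2 (fun j => L i j * du i * du j)))))).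

Proof.
intros x y r_ n g L Gamma du ddu PQ PQA PQB PQC C hPQ hne.
assert (Hr : forall s, in_itv t0 t1 s ->
  locally (u I1 s, u I2 s) (fun z => ex_diff_v r 2 (fst z) (snd z))).
{ intros s Hs; generalize (U_open _ (u_in_U s Hs)); apply filter_imp.
  intros [a b] Hab; apply ex_diff_v_m with 3%nat; [auto with arith|].
  exact (r_C3 a b Hab). }
assert (Hr1 : forall s, in_itv t0 t1 s ->
  locally (u I1 s, u I2 s) (fun z => ex_diff_v r 1 (fst z) (snd z))).
{ intros s Hs; generalize (Hr s Hs); apply filter_imp.
  intros z; apply ex_diff_v_m; auto with arith. }
assert (Hu : forall s, in_itv t0 t1 s -> forall i, ex_derive (u i) s).
{ intros s Hs i; apply (proj1 (u_C3 i s Hs) 1%nat); auto with arith. }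
assert (Hu2 : forall s, in_itv t0 t1 s -> forall i, ex_derive (Derive (u i)) s).
{ intros s Hs i; apply (proj1 (u_C3 i s Hs) 2%nat); auto with arith. }
assert (reg : cross (vpd I1 r x y) (vpd I2 r x y) <> 0%V) by now apply r_regular, u_in_U.
set (V := fun h => curve_v1 r u (t + h)).
assert (V0 : V 0 = curve_v1 r u t) by (unfold V; now rewrite Rplus_0_r).
assert (dPQ_itv : forall h, in_itv t0 t1 (t + h) ->
  forall d, is_derive (fun z => dot (PQ z) d) h (dot (V h) d)).
{ intros h Hh d.
  apply (is_derive_shift (fun z => dot (r (u I1 z) (u I2 z) - r x y)%V d)).
  now apply is_derive_curve_dot; [apply Hr1|apply Hu]. }
assert (dPQ0 : locally 0 (fun h =>
  forall d, is_derive (fun z => dot (PQ z) d) h (dot (V h) d))).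
{ generalize (locally_in_itv _ _ _ t_in); apply filter_imp; exact dPQ_itv. }
assert (dPQ : forall h, 0 < h < delta ->
  forall d, is_derive (fun z => dot (PQ z) d) h (dot (V h) d)).
{ intros h [h0 hd]; apply dPQ_itv; destruct t_in as [Ht0 _]; split.
  - apply Rbar_lt_le_trans with t; [exact Ht0|simpl; lra].
  - apply Rbar_lt_le_trans with (t + delta); [simpl; lra|exact delta_small]. }
assert (dV : forall d, is_derive (fun z => dot (V z) d) 0 (dot (curve_v2 r u t) d)).
{ intros d; apply (is_derive_shift (fun z => dot (curve_v1 r u z) d)).
  rewrite Rplus_0_r; apply is_derive_curve_v1_dot; auto. }
assert (PQ0 : PQ 0 = 0%V).
{ unfold PQ; rewrite Rplus_0_r; unfold x, y; vring. }
assert (dd : forall k l, dot (r_ l) (dual r k x y)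
   = match k, l with I1, I1 | I2, I2 => 1 | _, _ => 0 end) by (intros; now apply dot_dual).
assert (nd : forall k, dot n (dual r k x y) = 0) by (intros; apply dot_unit_normal_dual).
assert (rn : forall l, dot (r_ l) n = 0) by (intros; apply dot_unit_normal).
assert (nn : dot n n = 1) by now apply unit_normal_sqr.
assert (chi1E : forall h, 0 < h < delta -> chi1 h = dot (PQ h) (dual r I1 x y)).
{ intros h hh; rewrite hPQ, !dot_plus_l, !dot_scal_l, !dd, nd by easy; ring. }
assert (chi2E : forall h, 0 < h < delta -> chi2 h = dot (PQ h) (dual r I2 x y)).
{ intros h hh; rewrite hPQ, !dot_plus_l, !dot_scal_l, !dd, nd by easy; ring. }
assert (chi3E : forall h, 0 < h < delta -> chi3 h = dot (PQ h) n).
{ intros h hh; rewrite hPQ, !dot_plus_l, !dot_scal_l, !rn, nn by easy; ring. }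
(* Tangential components of the acceleration, that is, the second derivatives at 0 of the first two
   coefficients of PQ. *)
set (B := fun k => sum2 (fun i => sum2 (fun j => Gamma i j k * du i * du j)) + ddu k).
assert (V1d : forall k, dot (V 0) (dual r k x y) = du k).
{ intros k; rewrite V0; now apply dot_curve_v1_dual. }
assert (V1n : dot (V 0) n = 0) by (rewrite V0; apply dot_curve_v1_normal).
assert (V2d : forall k, dot (curve_v2 r u t) (dual r k x y) = B k).
{ intros k; apply dot_curve_v2_dual; auto. }
assert (V2n : dot (curve_v2 r u t) n = sum2 (fun i => sum2 (fun j => L i j * du i * du j)))
  by apply dot_curve_v2_normal.
(* Parts 2 and 3 differ only in the index of the tangent vector, so both are instances of this. *)
assert (normal_case : forall (k : idx) (chi : R -> R),
  (forall h, 0 < h < delta -> chi h = dot (PQ h) (dual r k x y)) ->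
  let w := fun h => (chi h *: r_ k + chi3 h *: n)%V in
  (forall h, 0 < h < delta -> w h <> 0%V) ->
  (forall h, 0 < h < delta ->
    let c := chi h in let c3 := chi3 h in
    let c' := Derive chi h in let c3' := Derive chi3 h in
    is_rot_speed w h
      (/ vnorm (c *: r_ k + c3 *: n)%V ^ 3 *
       vnorm ((c3 * c3' * c) *: r_ k
            - (c3 ^ 2 * c') *: r_ k
            + (c * c' * c3 * g k k) *: n
            - (c ^ 2 * c3' * g k k) *: n)%V)) /\
  (du k <> 0 ->
   is_rot_speed_0 w
     (1 / 2 * / vnorm (du k *: r_ k)%V *
      Rabs (sum2 (fun i => sum2 (fun j => L i j * du i * du j)))))).
{ intros k chi chiE w hw; split.
  - intros h hh c c3 c' c3'.
    refine (eq_rect _ (is_rot_speed w h) (is_rot_speed_projection PQ V delta chi chi3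
      _ _ (r_ k) n h (dPQ h hh) chiE chi3E hh (hw h hh)) _ _).
    (* The vector in the statement is the opposite of [turn], so the squared lengths are
       compared. *)
    f_equal; rewrite !norm_E3; f_equal.
    unfold turn; rewrite rn, nn; unfold g, gI; fold (r_ k).
    fold c c3 c' c3'.
    generalize (dot (r_ k) (r_ k)); intros; coords; ring.
  - intros hd.
    assert (hk : (du k *: r_ k <> 0)%V).
    (* Pairing with the dual vector recovers the coefficient, so a zero vector would force [du k] to
       vanish. *)
    { intros E; apply hd; transitivity (dot (du k *: r_ k)%V (dual r k x y)).
      - rewrite dot_scal_l, dd; destruct k; ring.
      - rewrite E; coords; ring. }
    assert (ha : (dot (V 0%R) (dual r k x y) *: r_ k + dot (V 0%R) n *: n <> 0)%V).
    { rewrite V1d, V1n; now replace (du k *: r_ k + 0%R *: n)%V with (du k *: r_ k)%V by vring. }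
    refine (eq_rect _ (is_rot_speed_0 w) (is_rot_speed_0_projection PQ V _ delta chi chi3
      _ _ (r_ k) n PQ0 delta_pos dPQ0 dV chiE chi3E ha) _ _).
    rewrite V1d, V2d, V1n, V2n; now apply vnorm_turn_normal. }
split; [split|split].
- intros h hh c1 c2 c1' c2'.
  refine (eq_rect _ (is_rot_speed PQA h) (is_rot_speed_projection PQ V delta chi1 chi2
    _ _ (r_ I1) (r_ I2) h (dPQ h hh) chi1E chi2E hh (proj1 (hne h hh))) _ _).
  (* Again the stated vector is the opposite of [turn]. *)
  f_equal; rewrite !norm_E3; f_equal.
  unfold turn, g, gI; fold (r_ I1) (r_ I2).
  fold c1 c2 c1' c2'.
  generalize (dot (r_ I1) (r_ I1)) (dot (r_ I1) (r_ I2)) (dot (r_ I2) (r_ I2)); intros.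
  coords; ring.
- assert (ha : (dot (V 0%R) (dual r I1 x y) *: r_ I1 + dot (V 0%R) (dual r I2 x y) *: r_ I2 <> 0)%V).
  { rewrite !V1d; intros h0; apply (curve_nondeg t t_in); cbv zeta.
    rewrite (vDerive_curve r u t (Hr1 t t_in) (Hu t t_in)).
    replace (curve_v1 r u t) with 0%V by (symmetry; exact h0).
    coords; ring. }
  refine (eq_rect _ (is_rot_speed_0 PQA) (is_rot_speed_0_projection PQ V _ delta chi1 chi2
    _ _ (r_ I1) (r_ I2) PQ0 delta_pos dPQ0 dV chi1E chi2E ha) _ _).
  rewrite !V1d, !V2d.
  f_equal.
  (* With v the velocity and a the tangential acceleration, [C I1] and [C I2] are the coordinates of
     (v . a) v - |v|^2 a, the opposite of [turn]; the sign disappears in the quadratic form. *)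
  assert (E : turn (du I1) (du I2) (B I1) (B I2) (r_ I1) (r_ I2)
     = (- C I1 *: r_ I1 + - C I2 *: r_ I2)%V).
  { assert (E1 : C I1 = - ((B I1 * du I2 - du I1 * B I2) * (du I1 * g I1 I2 + du I2 * g I2 I2))).
    { unfold C, B, sum2; ring. }
    assert (E2 : C I2 = (B I1 * du I2 - du I1 * B I2) * (du I1 * g I1 I1 + du I2 * g I1 I2)).
    { unfold C, B, sum2; rewrite (gI_comm r I2 I1 x y : g I2 I1 = g I1 I2); ring. }
    rewrite E1, E2; unfold turn, g, gI; fold (r_ I1) (r_ I2).
    generalize (dot (r_ I1) (r_ I1)) (dot (r_ I1) (r_ I2)) (dot (r_ I2) (r_ I2)); intros; vring. }
  rewrite E, vnorm_lin2; f_equal.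
  unfold sum2; rewrite (gI_comm r I2 I1 x y : g I2 I1 = g I1 I2); unfold g, gI; fold (r_ I1) (r_ I2); ring.
- apply (normal_case I1 chi1 chi1E); intros h hh; apply (hne h hh).
- apply (normal_case I2 chi2 chi2E); intros h hh; apply (hne h hh).
Qed.
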